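(* Let $G$ be a finite simple unmixed graph such that $I_c(G)$ is linearly presented. If $C_1,C_2$ are distinct minimal vertex covers of $G$ such that the induced subgraph $G[C_1\triangle C_2]$ is unmixed and not Cohen–Macaulay, then there is a minimal vertex cover $C$ of $G$ such that $C_1\cap C_2\not\subset C\subset C_1\cup C_2$.
   Context: $G$ has vertices $t_1,\dots,t_s$, $S=K[t_1,\dots,t_s]$, $K$ a field. A graph is unmixed if all minimal vertex covers (inclusion-minimal vertex sets meeting every edge) have equal size. $I_c(G)$ is generated by $\prod_{t_i\in C}t_i$ over minimal vertex covers $C$; a monomial ideal minimally generated by $u_1,\dots,u_r$ is linearly presented if all $u_i$ have the same degree and the kernel of $S^r\to S$, $e_i\mapsto u_i$, is generated by vectors with linear-form entries. $\triangle$ is symmetric difference, $G[L]$ the subgraph induced on $L$. A graph $H$ is Cohen–Macaulay if $R/I(H)$ is Cohen–Macaulay, with $R$ the polynomial ring on $V(H)$ and $I(H)$ generated by $tt'$ for edges $\{t,t'\}$ of $H$. *)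

(* Defs.v *)
From HB Require Import structures.
From mathcomp Require Import all_boot all_order all_algebra.
From mathcomp Require Import multinomials.mpoly.
Set Implicit Arguments. Unset Strict Implicit. Unset Printing Implicit Defensive.
Import Order.TTheory GRing.Theory.
Local Open Scope ring_scope.

Definition simple_graph (V : finType) (e : rel V) : Prop :=
  ssrbool.symmetric e /\ ssrbool.irreflexive e.

Definition vertex_cover (V : finType) (e : rel V) (C : {set V}) : bool :=
  [forall x, forall y, e x y ==> (x \in C) || (y \in C)].

Definition min_vertex_cover (V : finType) (e : rel V) (C : {set V}) : bool :=
  vertex_cover e C && [forall D : {set V}, (D \proper C) ==> ~~ vertex_cover e D].

Definition unmixed (V : finType) (e : rel V) : Prop :=
  forall C D : {set V}, min_vertex_cover e C -> min_vertex_cover e D -> #|C| = #|D|.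

Definition induced (V : finType) (e : rel V) (L : {set V}) : rel {x : V | x \in L} :=
  fun x y => e (val x) (val y).
Arguments induced {V} e L _ _.

Section CommAlg.
Variable R : comNzRingType.

Definition in_ideal (gs : seq R) (f : R) : Prop :=
  exists c : 'I_(size gs) -> R, f = \sum_(i < size gs) c i * gs`_i.

Definition is_ideal (P : R -> Prop) : Prop :=
  [/\ P 0, (forall a b, P a -> P b -> P (a + b)) & (forall a b, P b -> P (a * b))].

Definition is_prime_ideal (P : R -> Prop) : Prop :=
  [/\ is_ideal P, ~ P 1 & (forall a b, P (a * b) -> P a \/ P b)].

Definition dim_ge (gs : seq R) (d : nat) : Prop :=
  exists P : nat -> R -> Prop,
    (forall i, (i <= d)%N -> is_prime_ideal (P i)) /\
    (forall i, (i <= d)%N -> forall f, in_ideal gs f -> P i f) /\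
    (forall i, (i < d)%N ->
       (forall f, P i f -> P i.+1 f) /\ exists f, P i.+1 f /\ ~ P i f).

Definition is_krull_dim (gs : seq R) (d : nat) : Prop :=
  dim_ge gs d /\ ~ dim_ge gs d.+1.

Definition regular_seq (ms gs fs : seq R) : Prop :=
  (forall k, (k < size fs)%N -> in_ideal ms (nth 0 fs k)) /\
  (forall k, (k < size fs)%N -> forall g,
      in_ideal (gs ++ take k fs) (nth 0 fs k * g) -> in_ideal (gs ++ take k fs) g) /\
  ~ in_ideal (gs ++ fs) 1.

Definition depth_ge (ms gs : seq R) (d : nat) : Prop :=
  exists fs : seq R, size fs = d /\ regular_seq ms gs fs.

Definition is_depth (ms gs : seq R) (d : nat) : Prop :=
  depth_ge ms gs d /\ ~ depth_ge ms gs d.+1.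

(* R/(gs) is Cohen-Macaulay (graded sense): depth w.r.t. (ms) = dim *)
Definition cohen_macaulay (ms gs : seq R) : Prop :=
  exists d, is_krull_dim gs d /\ is_depth ms gs d.

End CommAlg.

Section GraphRings.
Variable K : fieldType.

Definition var (V : finType) (v : V) : {mpoly K[#|V|]} := 'X_(enum_rank v).

Definition max_gens (V : finType) : seq {mpoly K[#|V|]} :=
  [seq var v | v <- enum V].

Definition edge_gens (V : finType) (e : rel V) : seq {mpoly K[#|V|]} :=
  [seq var p.1 * var p.2 | p <- enum [pred p : V * V | e p.1 p.2]].

Definition CM_graph (V : finType) (e : rel V) : Prop :=
  cohen_macaulay (max_gens V) (edge_gens e).

Definition min_covers (V : finType) (e : rel V) : seq {set V} :=
  [seq C <- enum {set V} | min_vertex_cover e C].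

Definition cover_monomial (V : finType) (C : {set V}) : {mpoly K[#|V|]} :=
  \prod_(v in C) var v.

Definition cover_gens (V : finType) (e : rel V) : seq {mpoly K[#|V|]} :=
  [seq cover_monomial C | C <- min_covers e].

(* the monomial ideal minimally generated by u_1,...,u_r is linearly
   presented: the u_i have the same degree and the kernel of
   S^r -> S, e_i |-> u_i, is generated by vectors with linear entries *)
Definition linearly_presented (n : nat) (us : seq {mpoly K[n]}) : Prop :=
  (exists d, forall i, (i < size us)%N -> nth 0 us i \is d.-homog) /\
  exists (m : nat) (w : 'I_m -> 'I_(size us) -> {mpoly K[n]}),
    (forall j i, w j i \is 1%N.-homog) /\
    (forall j, \sum_(i < size us) w j i * us`_i = 0) /\
    (forall g : 'I_(size us) -> {mpoly K[n]},
        \sum_(i < size us) g i * us`_i = 0 ->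
        exists a : 'I_m -> {mpoly K[n]}, forall i, g i = \sum_(j < m) a j * w j i).

End GraphRings.

Definition symdiff (V : finType) (A B : {set V}) : {set V} := (A :\: B) :|: (B :\: A).

(* Main.v *)
Require Import Defs.
From mathcomp Require Import all_boot all_order all_algebra.
From mathcomp Require Import multinomials.mpoly.
From mathcomp Require Import zify.
Set Implicit Arguments. Unset Strict Implicit. Unset Printing Implicit Defensive.
Import GRing.Theory.
Local Open Scope ring_scope.

(** Suppose that every minimal vertex cover inside [C1 :|: C2] contains
    [C1 :&: C2].  Linear presentation joins [C1] to [C2] by a walk of minimal
    covers inside [C1 :|: C2] whose consecutive members differ by one exchange.
    Removing [C1 :&: C2], this is a walk of minimum covers of the bipartite graph
    [H] induced on the symmetric difference, from one side of [H] to the other.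
    Made monotone, it lists a perfect matching [a_i b_i] of [H] such that an edge
    [a_i b_j] forces [i <= j], and unmixedness makes the relation "[a_i b_j] is
    an edge" transitive.  Hence the [a_i - b_i] form a regular sequence modulo
    the edge ideal, of length half the number of vertices.  Neither a regular
    sequence nor a chain of primes can be longer: counting monomials, that many
    elements plus one satisfy a polynomial relation modulo the edge ideal, and
    cancelling the lexicographically least term of this relation step by step
    puts [1] in the last ideal of the sequence or chain. *)

(** * Ideals and algebraic dependence *)

Section Ideals.
Variable R : comNzRingType.
Implicit Types (gs hs : seq R) (P : R -> Prop) (f : R).

Lemma in_ideal_is_ideal gs : is_ideal (in_ideal gs).
Proof.
split.
- by exists (fun _ => 0); rewrite big1 // => i _; rewrite mul0r.
- move=> a b [c ->] [d ->]; exists (fun i => c i + d i).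
  by rewrite -big_split; apply: eq_bigr => i _; rewrite mulrDl.
- move=> a b [c ->]; exists (fun i => a * c i).
  by rewrite mulr_sumr; apply: eq_bigr => i _; rewrite mulrA.
Qed.

Lemma ideal_sum P (I : eqType) (r : seq I) (F : I -> R) : is_ideal P ->
  (forall i, i \in r -> P (F i)) -> P (\sum_(i <- r) F i).
Proof.
move=> [P0 PD _]; elim: r => [|i r IH] PF; first by rewrite big_nil.
rewrite big_cons; apply: PD; first by apply: PF; rewrite mem_head.
by apply: IH => j jr; apply: PF; rewrite in_cons jr orbT.
Qed.

Lemma idealMr P a b : is_ideal P -> P a -> P (a * b).
Proof. by move=> [_ _ PM] Pa; rewrite mulrC; apply: PM. Qed.

Lemma idealN P a : is_ideal P -> P a -> P (- a).
Proof. by move=> [_ _ PM] Pa; rewrite -mulN1r; apply: PM. Qed.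

Lemma idealB P a b : is_ideal P -> P a -> P b -> P (a - b).
Proof. by move=> iP Pa Pb; case: (iP) => _ PD _; apply: PD => //; apply: idealN. Qed.

Lemma mem_in_ideal gs g : g \in gs -> in_ideal gs g.
Proof.
move=> gin; have ltg: (index g gs < size gs)%N by rewrite index_mem.
exists (fun i => (i == Ordinal ltg)%:R).
rewrite (bigD1 (Ordinal ltg)) //= eqxx mul1r nth_index // big1 ?addr0 //.
by move=> i /negbTE ->; rewrite mul0r.
Qed.

Lemma in_ideal_min gs P f : is_ideal P -> (forall g, g \in gs -> P g) ->
  in_ideal gs f -> P f.
Proof.
move=> iP Pgs [c ->]; apply: ideal_sum => // i _.
by case: (iP) => _ _; apply; apply/Pgs/mem_nth.
Qed.

Lemma in_ideal_sub gs hs f : {subset gs <= hs} -> in_ideal gs f -> in_ideal hs f.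
Proof.
move=> sgh; apply: in_ideal_min; first exact: in_ideal_is_ideal.
by move=> g /sgh; apply: mem_in_ideal.
Qed.

End Ideals.

(** * Polynomial relations between elements of a polynomial ring *)

Section Dependence.

Fixpoint exponents (M N : nat) : seq (seq nat) :=
  if N is N'.+1 then [seq j :: t | j <- iota 0 M, t <- exponents M N']
  else [:: [::]].

Lemma size_exponents M N : size (exponents M N) = (M ^ N)%N.
Proof. by elim: N => //= N IH; rewrite size_allpairs IH size_iota expnS. Qed.

Lemma exponents_uniq M N : uniq (exponents M N).
Proof.
elim: N => //= N IH; apply: allpairs_uniq => //; first exact: iota_uniq.
by move=> [i s] [j t] _ _ [-> ->].
Qed.

Lemma mem_exponents M N t :
  (t \in exponents M N) = (size t == N) && all (fun j => j < M)%N t.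
Proof.
elim: N t => [|N IH] t; first by case: t.
apply/allpairsP/idP => [[[j s] /= []]|].
  rewrite mem_iota add0n IH => /andP[_ jM] /andP[/eqP <- aM] ->.
  by rewrite /= eqxx jM.
case: t => //= j t; rewrite eqSS => /and3P[st jM aM].
by exists (j, t); rewrite mem_iota IH /= st jM aM.
Qed.

Variables (K : fieldType) (n : nat).
Local Notation S := {mpoly K[n]}.
Implicit Types (fs : seq S) (t : seq nat).

Fixpoint power_prod fs t : S :=
  if fs is f :: fs' then f ^+ head 0%N t * power_prod fs' (behead t) else 1.

Definition poly_value M fs (c : seq nat -> K) : S :=
  \sum_(t <- exponents M (size fs)) c t *: power_prod fs t.

Lemma poly_value_cons M f fs c :
  poly_value M (f :: fs) c =
  \sum_(j < M) f ^+ j * poly_value M fs (fun t => c ((j : nat) :: t)).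
Proof.
rewrite -(big_mkord xpredT (fun j => f ^+ j * poly_value M fs (fun t => c (j :: t)))).
rewrite /poly_value /= big_allpairs_dep /=.
rewrite /index_iota subn0.
by apply: eq_bigr => j _; rewrite mulr_sumr; apply: eq_bigr => t _; rewrite scalerAr.
Qed.

(* Splitting off the least power of [f_0] in the relation and cancelling it
   leaves a relation between the remaining elements modulo [f_0]. *)
Lemma chain_independent M fs (J : nat -> S -> Prop) (c : seq nat -> K) :
  (forall i, (i <= size fs)%N -> is_ideal (J i)) ->
  (forall i, (i < size fs)%N -> forall g, J i g -> J i.+1 g) ->
  (forall i, (i < size fs)%N -> J i.+1 fs`_i) ->
  (forall i, (i < size fs)%N -> forall g, J i (fs`_i * g) -> J i g) ->
  ~ J (size fs) 1 ->
  J 0%N (poly_value M fs c) ->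
  forall t, t \in exponents M (size fs) -> c t = 0.
Proof.
elim: fs J c => [|f fs IH] J c iJ Jle Jf Jreg J1 J0 t.
  rewrite inE => /eqP ->; apply/eqP; case: eqP => // /eqP c0; case: J1 => /=.
  have -> : (1 : S) = (c [::])^-1%:MP * (poly_value M [::] c).
    rewrite /poly_value big_seq1 /= -mul_mpolyC mulr1 -mpolyCM mulVf //.
  by case: (iJ 0%N isT) => _ _; apply.
suff H : forall j, (j < M)%N -> poly_value M fs (fun t => c (j :: t)) = 0 /\
    forall t, t \in exponents M (size fs) -> c (j :: t) = 0.
  by case/allpairsP => -[j s] /= []; rewrite mem_iota add0n => /H[_ +] + ->; apply.
move=> j; have [k] := ubnP j; elim: k j => // k IHk j; rewrite ltnS => jk jM.
have lt0 : forall i : 'I_M, (i < j)%N -> poly_value M fs (fun t => c ((i : nat) :: t)) = 0.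
  by move=> i ij; case: (IHk i (leq_trans ij jk) (ltn_ord i)).
have c0 : forall t, t \in exponents M (size fs) -> c (j :: t) = 0.
  apply: (IH (fun i => J i.+1)) => //.
  - by move=> i ?; apply: iJ.
  - by move=> i ?; apply: Jle.
  - by move=> i ?; apply: Jf.
  - by move=> i ? g; apply: (Jreg i.+1).
  have iJ1 : is_ideal (J 1%N) by apply: iJ.
  pose h := \sum_(i < M | (j < i)%N)
    f ^+ (i - j).-1 * poly_value M fs (fun t => c ((i : nat) :: t)).
  have E : poly_value M (f :: fs) c =
      f ^+ j * (poly_value M fs (fun t => c (j :: t)) + f * h).
    rewrite poly_value_cons (bigID (fun i : 'I_M => (i < j)%N)) /=.
    rewrite big1 ?add0r => [|i /lt0 ->]; last by rewrite mulr0.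
    rewrite (bigD1 (Ordinal jM)) /=; last by rewrite ltnn.
    rewrite mulrDr; congr (_ + _); rewrite !mulr_sumr.
    apply: eq_big => [i|i /andP[ij ne]]; first by rewrite -leqNgt ltn_neqAle andbC eq_sym.
    rewrite !mulrA -exprSr -exprD; congr (_ ^+ _ * _).
    have : (j != i)%N by rewrite eq_sym.
    by move: ij => /eqP; lia.
  have reg : forall i g, J 0%N (f ^+ i * g) -> J 0%N g.
    elim=> [|i IHi] g; first by rewrite mul1r.
    by rewrite exprS -mulrA => /(Jreg 0%N isT) /IHi.
  move: J0; rewrite E => /reg /(Jle 0%N isT) Jh.
  have -> : poly_value M fs (fun t => c (j :: t)) =
     (poly_value M fs (fun t => c (j :: t)) + f * h) - f * h by rewrite addrK.
  by apply: idealB => //; apply: idealMr => //; apply: (Jf 0%N).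
split=> //; rewrite /poly_value big1_seq // => s /andP[_ ss].
by rewrite c0 // scale0r.
Qed.

(** A matrix with more rows than columns has a nonzero vector in its left kernel. *)
Lemma linear_relation (T U : eqType) (rows : seq T) (cols : seq U) (F : T -> U -> K) :
  uniq rows -> (size cols < size rows)%N ->
  exists c : T -> K, (exists2 t : T, t \in rows & c t != 0) /\
    forall u, u \in cols -> \sum_(x <- rows) c x * F x u = 0.
Proof.
case: rows => // t0 rows'; set rows := _ :: _ => Ur lt.
case: cols lt => [|u0 cols'] lt.
  by exists (fun=> 1); split=> //; exists t0; rewrite ?mem_head ?oner_neq0.
move: lt; set cols := _ :: _ => lt.
pose A := \matrix_(i < size rows, j < size cols) F (nth t0 rows i) (nth u0 cols j).
have : kermx A != 0.
  rewrite -mxrank_eq0 mxrank_ker subn_eq0 -ltnNge.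
  exact: leq_ltn_trans (rank_leq_col A) lt.
case/rowV0Pn => v /sub_kermxP vA /rV0Pn [i vi].
exists (fun t : T => \sum_(k < size rows | nth t0 rows k == t) v 0 k).
have E (k : 'I_(size rows)) :
    \sum_(k' < size rows | nth t0 rows k' == nth t0 rows k) v 0 k' = v 0 k.
  by rewrite (big_pred1 k) // => k'; rewrite /= nth_uniq.
split; first by exists (nth t0 rows i); rewrite ?mem_nth ?E.
move=> u uc; have lu : (index u cols < size cols)%N by rewrite index_mem.
move/matrixP/(_ 0 (Ordinal lu)): vA; rewrite !mxE => vA; rewrite -[RHS]vA.
rewrite (big_nth t0) big_mkord; apply: eq_bigr => k _.
by rewrite E mxE nth_index.
Qed.

Definition deg_le (d : nat) (f : S) := forall m, m \in msupp f -> (mdeg m <= d)%N.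

Lemma deg_leM d1 d2 f g : deg_le d1 f -> deg_le d2 g -> deg_le (d1 + d2) (f * g).
Proof.
move=> df dg m /msuppM_le /allpairsP[[m1 m2] /= [/df h1 /dg h2 ->]].
by rewrite mdegD leq_add.
Qed.

Lemma deg_le1 d : deg_le d 1.
Proof. by move=> m; rewrite -mpolyC1 msupp1 inE => /eqP ->; rewrite mdeg0. Qed.

Lemma deg_leX d k f : deg_le d f -> deg_le (k * d) (f ^+ k).
Proof.
move=> df; elim: k => [|k IH]; first exact: deg_le1.
by rewrite exprS mulSn; apply: deg_leM.
Qed.

Lemma deg_le_power_prod M d fs t : (forall f, f \in fs -> deg_le d f) ->
  t \in exponents M (size fs) -> deg_le (size fs * (M * d)) (power_prod fs t).
Proof.
elim: fs t => [|f fs IH] t df; first by move=> _; apply: deg_le1.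
case/allpairsP => -[j s] /= []; rewrite mem_iota add0n => jM sM ->.
rewrite mulSn; apply: deg_leM; last first.
  by apply: IH => // g gfs; apply: df; rewrite in_cons gfs orbT.
have df0 : deg_le d f by apply: df; rewrite mem_head.
move=> m /(deg_leX df0) /leq_trans; apply.
by rewrite leq_mul2r (ltnW jM) orbT.
Qed.

Lemma deg_le_bound fs : exists d, forall f, f \in fs -> deg_le d f.
Proof.
elim: fs => [|f fs [d df]]; first by exists 0%N.
exists (maxn d (msize f)) => g; rewrite in_cons => /orP[/eqP ->|/df h] m mg.
  by rewrite leq_max (ltnW (msize_mdeg_lt mg)) orbT.
by rewrite leq_max h.
Qed.

End Dependence.

(** * Monomial ideals *)

Section MonomialIdeals.
Variables (K : fieldType) (n : nat).
Local Notation S := {mpoly K[n]}.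
Implicit Types (U : pred 'X_{1..n}) (u v m : 'X_{1..n}) (f g h : S).

(** The span of the monomials in [U], an ideal as soon as [U] is up-closed. *)
Definition monomial_ideal U f := forall m, m \in msupp f -> U m.

Definition up_closed U := forall u v, U u -> U (u + v)%MM.

Lemma monomial_ideal_is_ideal U : up_closed U -> is_ideal (monomial_ideal U).
Proof.
move=> upU; split.
- by move=> m; rewrite -(mpolyC0 n K) msupp0.
- by move=> f g If Ig m /msuppD_le; rewrite mem_cat => /orP[/If|/Ig].
- move=> f g Ig m /msuppM_le /allpairsP[[u v] /= [_ /Ig Uv ->]].
  by rewrite addmC; apply: upU.
Qed.

Lemma monomial_ideal_min U (P : S -> Prop) f : is_ideal P ->
  (forall m, U m -> P 'X_[m]) -> monomial_ideal U f -> P f.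
Proof.
move=> iP PU If; rewrite [f]mpolyE; apply: ideal_sum => // m /If /PU Pm.
by case: (iP) => _ _ PM; rewrite -mul_mpolyC; apply: PM.
Qed.

Lemma mcoeff_mulX f u v : (f * 'X_[u])@_v = if (u <= v)%MM then f@_(v - u)%MM else 0.
Proof.
case: ifP => [uv|nuv]; first by rewrite -{1}(submK uv) addmC mcoeffMX.
apply/eqP; rewrite mcoeff_eq0; apply/negP => /msuppM_le /allpairsP[[a b] /= [_]].
rewrite msuppX inE => /eqP -> E; move: nuv; rewrite E.
by rewrite lem_addl.
Qed.

(** If [u] occurs in [h] and no [u + k U_(i)] lay in [U], the coefficient of the product at
    [u + U_(i)] would vanish, so that [u + U_(i) - U_(j)] would occur in [h] as well. Iterating, the
    exponent of [X_j] would become negative. *)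
Lemma nzd_chain U (i j : 'I_n) h u : up_closed U -> i != j ->
  monomial_ideal U (('X_i - 'X_j) * h) -> h@_u != 0 ->
  exists k, U (u + U_(i) *+ k)%MM.
Proof.
move=> upU ij Ih hu.
case: (boolP [exists k : 'I_(u j).+2, U (u + U_(i) *+ k)%MM]) => [/existsP[k Uk]|].
  by exists k.
move/existsPn => nU.
(* [v] is [u] after [k] such moves; [k = (u j).+1] is one more than the exponent of [X_j] allows. *)
have H : forall k, (k <= (u j).+1)%N ->
    exists2 v, (v + U_(j) *+ k = u + U_(i) *+ k)%MM & h@_v != 0.
  elim=> [|k IHk] ku; first by exists u.
  have [v E hv] := IHk (ltnW ku).
  pose w := (v + U_(i))%MM.
  have Ew : (w + U_(j) *+ k = u + U_(i) *+ k.+1)%MM.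
    by rewrite /w -addmA [(U_(i) + _)%MM]addmC addmA E -addmA mulmSr.
  have /eqP : (('X_i - 'X_j) * h)@_w = 0.
    apply/eqP; rewrite mcoeff_eq0; apply/negP => /Ih /(upU _ (U_(j) *+ k)%MM).
    by rewrite Ew (negbTE (nU (Ordinal (ku : (k.+1 < (u j).+2)%N)))).
  rewrite mulrBl mcoeffB ![_ * h]mulrC !mcoeff_mulX lem_addl /w addmK subr_eq0.
  case: ifP => [jw|_]; last by rewrite (negbTE hv).
  move=> /eqP hE; exists (v + U_(i) - U_(j))%MM; last by rewrite -hE.
  by rewrite mulmS addmA (submK jw).
have [v /mnmP/(_ j) + _] := H _ (leqnn _).
by rewrite !mnmDE !mulmnE !mnm1E eqxx (negbTE ij) mul1n mul0n; lia.
Qed.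

(** [nzd_chain] for [X_i - X_j] and for its opposite brings each monomial of [h] into [U] by a power
    of [X_i] and by a power of [X_j]. *)
Lemma monomial_ideal_nzd U (i j : 'I_n) h : up_closed U -> i != j ->
  (forall u k l, U (u + U_(i) *+ k)%MM -> U (u + U_(j) *+ l)%MM -> U u) ->
  monomial_ideal U (('X_i - 'X_j) * h) -> monomial_ideal U h.
Proof.
move=> upU ij HU Ih u; rewrite mcoeff_msupp => hu.
have Ih' : monomial_ideal U (('X_j - 'X_i) * h).
  by rewrite -opprB mulNr => m; rewrite (perm_mem (msuppN _)); apply: Ih.
have [k Uk] := nzd_chain upU ij Ih hu; rewrite eq_sym in ij.
by have [l Ul] := nzd_chain upU ij Ih' hu; apply: HU Uk Ul.
Qed.

End MonomialIdeals.

(** * Edge ideals *)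

Section Covers.
Variables (V : finType) (e : rel V).
Implicit Types C D : {set V}.

Lemma vertex_coverP C :
  reflect (forall x y, e x y -> x \notin C -> y \in C) (vertex_cover e C).
Proof.
apply: (iffP forallP) => [H x y exy xC|H x].
  by have /forallP/(_ y)/implyP/(_ exy) := H x; rewrite (negbTE xC).
apply/forallP => y; apply/implyP => exy.
by case: (boolP (x \in C)) => //= xC; apply: H exy xC.
Qed.

Lemma min_vertex_coverE C : min_vertex_cover e C = minset (vertex_cover e) C.
Proof.
apply/andP/minsetP => [[cC /forallP mC]|[cC mC]]; split=> //.
  move=> D cD DC; apply/eqP; have := mC D; rewrite properEneq DC andbT cD /=.
  by rewrite implybF negbK.
apply/forallP => D; apply/implyP; rewrite properEneq => /andP[/eqP neD DC].
by apply/negP => cD; apply: neD; apply: mC.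
Qed.

Lemma min_vertex_cover_exists C : vertex_cover e C ->
  exists2 D, min_vertex_cover e D & D \subset C.
Proof.
by move=> /minset_exists[D mD DC]; exists D; rewrite // min_vertex_coverE.
Qed.

End Covers.

(** * Substitution homomorphisms: congruences and kernels *)

Section Substitution.
Variables (K : fieldType) (n : nat).
Local Notation S := {mpoly K[n]}.
Implicit Types (P : S -> Prop) (lq : n.-tuple S).

Lemma comp_mpoly_congr P lq f : is_ideal P -> (forall i, P ('X_i - tnth lq i)) ->
  P (f - (f \mPo lq)).
Proof.
move=> iP Plq; have [P0 PD PM] := iP.
have PprodB (a a' b b' : S) : P (a - a') -> P (b - b') -> P (a * b - a' * b').
  move=> Pa Pb; have -> : a * b - a' * b' = a * (b - b') + b' * (a - a').
    by rewrite !mulrBr [b' * a]mulrC [b' * a']mulrC addrA subrK.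
  by apply: PD; apply: PM.
elim/mpolyind: f => [|c m f _ _ IHf]; first by rewrite comp_mpoly0 subrr.
rewrite comp_mpolyD comp_mpolyZ opprD addrACA -!mul_mpolyC -mulrBr.
apply: PD => //; apply: PM.
rewrite comp_mpolyX mpolyXE_id.
elim/big_rec2: _ => [|i a b _ Pab]; first by rewrite subrr.
apply: (PprodB) => //; elim: (m i) => [|k IH]; first by rewrite subrr.
by rewrite !exprS; apply: PprodB.
Qed.

Lemma kernel_is_prime lq : is_prime_ideal (fun f => f \mPo lq = 0).
Proof.
split; first split.
- exact: raddf0.
- by move=> a b a0 b0; rewrite raddfD /= a0 b0 addr0.
- by move=> a b b0; rewrite rmorphM /= b0 mulr0.
- by rewrite rmorph1; apply/eqP/oner_neq0.
- by move=> a b; rewrite rmorphM => /eqP; rewrite mulf_eq0 => /orP[]/eqP; [left|right].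
Qed.

End Substitution.

Section EdgeIdeals.
Variables (K : fieldType) (V : finType) (e : rel V).
Local Notation S := {mpoly K[#|V|]}.
Local Notation rk := enum_rank.
Implicit Types (p : V -> V) (m : 'X_{1..#|V|}) (f : S).

(** The monomials of the edge ideal after renaming the variables along [p]; [p = id] gives the edge
    ideal itself. *)
Definition edge_multiple p m :=
  [exists x, exists y, e x y && (U_(rk (p x)) + U_(rk (p y)) <= m)%MM].

Lemma edge_multipleP p m :
  reflect (exists x y, e x y /\ (U_(rk (p x)) + U_(rk (p y)) <= m)%MM)
    (edge_multiple p m).
Proof.
apply: (iffP existsP) => [[x /existsP[y /andP[exy le]]]|[x [y [exy le]]]].
  by exists x, y.
by exists x; apply/existsP; exists y; rewrite exy.
Qed.

Lemma edge_multiple_up p : up_closed (edge_multiple p).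
Proof.
move=> u v /edge_multipleP[x [y [exy le]]]; apply/edge_multipleP; exists x, y.
by split=> //; apply: lepm_trans le (lem_addr _ _).
Qed.

Lemma edge_gensP g :
  reflect (exists x y, e x y /\ g = var K x * var K y) (g \in edge_gens K e).
Proof.
apply: (iffP mapP) => [[[x y]]|[x [y [exy ->]]]].
  by rewrite mem_enum inE /= => exy ->; exists x, y.
by exists (x, y); rewrite // mem_enum inE.
Qed.

Definition vsubst p : #|V|.-tuple S := [tuple var K (p (enum_val i)) | i < #|V|].

Lemma vsubst_var p v : var K v \mPo vsubst p = var K (p v).
Proof. by rewrite comp_mpolyXU -tnth_nth tnth_mktuple enum_rankK. Qed.

(** The substitution along [p] kills [fs] and changes nothing modulo [fs], so membership can be
    tested after it, where the edge generators are still monomials. *)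
Lemma in_edge_ideal_vsubst p (fs : seq S) f :
  (forall g, g \in fs -> g \mPo vsubst p = 0) ->
  (forall v, in_ideal fs (var K v - var K (p v))) ->
  in_ideal (edge_gens K e ++ fs) f <-> monomial_ideal (edge_multiple p) (f \mPo vsubst p).
Proof.
move=> fs0 fsp; have upe := @edge_multiple_up p.
have [E0 ED EM] := monomial_ideal_is_ideal K upe.
split=> [|Ef].
  apply: (in_ideal_min (P := fun f => monomial_ideal (edge_multiple p) (f \mPo vsubst p))).
    split=> [|a b Ha Hb|a b Hb]; first by rewrite raddf0.
      by rewrite raddfD; apply: ED.
    by rewrite rmorphM; apply: EM.
  move=> g; rewrite mem_cat => /orP[/edge_gensP[x [y [exy ->]]]|/fs0 -> //].
  rewrite rmorphM /= !vsubst_var -mpolyXD => m; rewrite msuppX inE => /eqP ->.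
  by apply/edge_multipleP; exists x, y; rewrite lepm_refl.
have iI := in_ideal_is_ideal (edge_gens K e ++ fs); have [_ ID IM] := iI.
have Ip v : in_ideal (edge_gens K e ++ fs) (var K v - var K (p v)).
  by apply: in_ideal_sub (fsp v) => g; rewrite mem_cat orbC => ->.
rewrite -(subrK (f \mPo vsubst p) f); apply: (ID).
  apply: comp_mpoly_congr => // i.
  by have := Ip (enum_val i); rewrite /var enum_valK tnth_mktuple.
apply: monomial_ideal_min Ef => // m /edge_multipleP[x [y [exy le]]].
rewrite -(submK le) mpolyXD; apply: (IM); rewrite mpolyXD.
have -> : 'X_[U_(rk (p x))] * 'X_[U_(rk (p y))] =
   var K x * var K y - (var K x * (var K y - var K (p y)) +
    var K (p y) * (var K x - var K (p x))).
  rewrite !mulrBr /var [_ * 'X_(rk x)]mulrC [_ * 'X_(rk (p x))]mulrC addrA subrK.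
  by rewrite opprB addrC subrK.
apply: idealB => //; last by apply: (ID); apply: (IM).
by apply: mem_in_ideal; rewrite mem_cat; apply/orP; left; apply/edge_gensP; exists x, y.
Qed.

Lemma in_edge_ideal f : monomial_ideal (edge_multiple id) f -> in_ideal (edge_gens K e) f.
Proof.
move=> Ef; rewrite -[edge_gens K e]cats0; apply/(@in_edge_ideal_vsubst id) => //.
  by move=> v; rewrite subrr; case: (in_ideal_is_ideal (nil : seq S)).
suff -> : vsubst id = [tuple 'X_i | i < #|V|] by rewrite comp_mpoly_id.
by apply: eq_mktuple => i; rewrite /var enum_valK.
Qed.

Definition zsubst (C : {set V}) : #|V|.-tuple S :=
  [tuple if enum_val i \in C then 0 else 'X_i | i < #|V|].

Lemma zsubst_var (C : {set V}) (v : V) : var K v \mPo zsubst C = if v \in C then 0 else var K v.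
Proof. by rewrite comp_mpolyXU -tnth_nth tnth_mktuple enum_rankK. Qed.

Lemma var_neq0 (v : V) : var K v != 0.
Proof. by rewrite -msupp_eq0 msuppX. Qed.

(** Setting the variables of a vertex set to zero has a prime kernel. Starting from [C] and adding
    one vertex of the complement at a time gives a strict chain of such primes, all containing the
    edge ideal because their vertex sets are covers. *)
Lemma dim_ge_independent C : vertex_cover e C -> dim_ge (edge_gens K e) #|~: C|.
Proof.
move=> /vertex_coverP cC.
pose D i := C :|: [set x in take i (enum (~: C))].
exists (fun i f => f \mPo zsubst (D i) = 0); split; last split.
- by move=> i _; apply: kernel_is_prime.
- move=> i _ f; apply: (in_ideal_min (P := fun f => f \mPo zsubst (D i) = 0)).
    by case: (kernel_is_prime (zsubst (D i))).
  move=> g /edge_gensP[x [y [exy ->]]]; rewrite rmorphM /= !zsubst_var !inE.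
  case: (boolP (x \in C)) => [|/(cC _ _ exy) ->]; first by rewrite mul0r.
  by rewrite mulr0.
move=> i iC.
have lt : (i < size (enum (~: C)))%N by rewrite -cardE.
have [v0] : exists v0, v0 \in ~: C by apply/card_gt0P; apply: leq_ltn_trans iC.
move=> _; have take1 := take_nth v0 lt.
set v := nth v0 _ _ in take1.
have DS : D i \subset D i.+1.
  by apply: setUS; apply/subsetP => x; rewrite !inE take1 mem_rcons inE orbC => ->.
split=> [f f0|].
  have [iP _ _] := kernel_is_prime (zsubst (D i.+1)).
  have := @comp_mpoly_congr _ _ _ (zsubst (D i)) f iP; rewrite f0 subr0; apply=> j.
  rewrite tnth_mktuple.
  case: ifP => [jD|_]; last by rewrite subrr raddf0.
  rewrite subr0 -[j]enum_valK -/(var K _) zsubst_var.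
  by rewrite (subsetP DS).
exists (var K v); rewrite !zsubst_var !inE take1 mem_rcons inE eqxx orbT; split=> //.
have : v \in ~: C by rewrite -mem_enum mem_nth.
rewrite inE => /negbTE -> /=.
have : uniq (take i.+1 (enum (~: C))) by rewrite take_uniq ?enum_uniq.
by rewrite take1 rcons_uniq => /andP[/negbTE -> _]; apply/eqP/var_neq0.
Qed.

(** A monomial outside the edge ideal is supported off some minimal cover, hence on [r] vertices.
    Those of degree at most [D] number at most [2 ^ #|V| * D.+1 ^ r], while there are [M ^ r.+1]
    unknown coefficients; for large [M], linear algebra yields a relation. *)
Lemma edge_ideal_dependence r (fs : seq S) :
  irreflexive e -> (forall C, min_vertex_cover e C -> #|~: C| = r) ->
  size fs = r.+1 -> exists M c, (exists2 t, t \in exponents M (size fs) & c t != 0) /\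
    in_ideal (edge_gens K e) (poly_value M fs c).
Proof.
move=> irr cardC sfs; have [d dfs] := deg_le_bound fs.
(* [b] makes [D < M * b], so there are at most [2 ^ #|V| * (M * b) ^ r] equations; this is below
   [M ^ r.+1] because [M] exceeds [2 ^ #|V| * b ^ r]. *)
pose b := (r.+1 * d).+1; pose M := (2 ^ #|V| * b ^ r).+1.
pose D := (size fs * (M * d))%N.
pose mono (Ch : {set V} * seq nat) : 'X_{1..#|V|} := [multinom
  (if enum_val i \in Ch.1 then 0%N
   else nth 0%N Ch.2 (index (enum_val i) (enum (~: Ch.1)))) | i < #|V|].
pose cols := [seq (C, h) | C <- enum {set V}, h <- exponents D.+1 r].
pose F t Ch : K := (power_prod fs t)@_(mono Ch).
have lt : (size cols < size (exponents M (size fs)))%N.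
  have card2 : #|{set V}| = (2 ^ #|V|)%N.
    by rewrite -(cardsT {set V}) -powersetT card_powerset cardsT.
  rewrite size_allpairs !size_exponents -cardE card2.
  apply: (@leq_ltn_trans (2 ^ #|V| * (M * b) ^ r)).
    have Db : (D < M * b)%N by rewrite /D /b sfs; lia.
    rewrite leq_mul2l; apply/orP; right.
    case: (posnP r) => [r0|r0]; last by rewrite leq_exp2r.
    by rewrite [X in (_ ^ X <= _)%N]r0 [X in (_ <= _ ^ X)%N]r0 !expn0.
  by rewrite expnMn sfs expnS mulnCA mulnC ltn_mul2r expn_gt0 /= ltnSn.
have [c [nzc c0]] := linear_relation F (exponents_uniq M (size fs)) lt.
exists M, c; split=> //; apply: in_edge_ideal => m mf.
case: (boolP (edge_multiple id m)) => // nEm; exfalso.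
have mD : (mdeg m <= D)%N.
  move: mf; rewrite /poly_value => /msupp_sum_le /flattenP[s /mapP[t]].
  rewrite mem_filter /= => tM -> /msuppZ_le; exact: deg_le_power_prod.
have : vertex_cover e [set v | m (rk v) == 0%N].
  apply/vertex_coverP => x y exy; rewrite !inE => mx; apply/negPn/negP => my.
  case/negP: nEm; apply/edge_multipleP; exists x, y; split=> //=.
  apply/mnm_lepP => i; rewrite mnmDE !mnm1E.
  have ne : rk x != rk y by apply/eqP => /enum_rank_inj xy; move: (irr x); rewrite {2}xy exy.
  case: (eqVneq (rk x) i) => [xi|_]; first by rewrite -xi eq_sym (negbTE ne) addn0 lt0n.
  by case: eqP => // <-; rewrite lt0n.
case/min_vertex_cover_exists => C mC /subsetP Cm.
have Em : m = mono (C, [seq m (rk v) | v <- enum (~: C)]).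
  apply/mnmP => i; rewrite mnmE /=; case: ifP => iC.
    by have := Cm _ iC; rewrite inE enum_valK => /eqP.
  have iC' : enum_val i \in enum (~: C) by rewrite mem_enum inE iC.
  by rewrite (nth_map (enum_val i)) ?index_mem // nth_index // enum_valK.
move: mf; rewrite mcoeff_msupp => /negP; apply; apply/eqP.
rewrite /poly_value raddf_sum /=.
under eq_bigr do rewrite mcoeffZ.
rewrite {1}Em; apply: c0; apply/allpairsP; exists (C, [seq m (rk v) | v <- enum (~: C)]).
rewrite mem_enum mem_exponents size_map -cardE cardC //= eqxx; split=> //.
apply/allP => _ /mapP[v _ ->]; rewrite ltnS (leq_trans _ mD) //.
by rewrite mdegE (bigD1 (rk v)) //= leq_addr.
Qed.

(** Finite choice by induction on [N], for a property that need not be decidable. *)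
Lemma choose_seq (Q : nat -> S -> Prop) N : (forall i, (i < N)%N -> exists f, Q i f) ->
  exists2 fs : seq S, size fs = N & forall i, (i < N)%N -> Q i fs`_i.
Proof.
elim: N => [|N IH] H; first by exists [::].
have [i iN|fs sfs Qfs] := IH; first by apply: H; apply: ltnW.
have [f Qf] := H N (ltnSn N); exists (rcons fs f); first by rewrite size_rcons sfs.
move=> i; rewrite ltnS leq_eqVlt nth_rcons sfs => /orP[/eqP ->|iN].
  by rewrite ltnn eqxx.
by rewrite iN; apply: Qfs.
Qed.

(** Choose [f_i] in [P i.+1] outside [P i]. Primality lets [f_i] cancel modulo [P i], so these
    [r.+1] elements would be independent modulo the edge ideal, against [edge_ideal_dependence]. *)
Lemma krull_dim_edge_ideal r :
  irreflexive e -> (forall C, min_vertex_cover e C -> #|~: C| = r) ->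
  ~ dim_ge (edge_gens K e) r.+1.
Proof.
move=> irr cardC [P [Pprime [PI Plt]]].
have [|fs sfs Qfs] := @choose_seq (fun i f => P i.+1 f /\ ~ P i f) r.+1.
  by move=> i /Plt[].
have [M [c [[t tM /eqP ct] Ic]]] := edge_ideal_dependence irr cardC sfs.
apply: ct; apply: (chain_independent (J := P) _ _ _ _ _ _ tM); rewrite ?sfs.
- by move=> i ir; case: (Pprime i ir).
- by move=> i /Plt[].
- by move=> i /Qfs[].
- move=> i ir g; have [_ _ pr] := Pprime i (ltnW ir).
  by case/pr => // Pf; case: (Qfs i ir).
- by case: (Pprime r.+1 (leqnn _)).
- exact: (PI 0%N).
Qed.

(** Here the chain consists of the edge ideal enlarged by the first [i] elements, and regularity
    provides the cancellation. *)
Lemma depth_edge_ideal r ms :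
  irreflexive e -> (forall C, min_vertex_cover e C -> #|~: C| = r) ->
  ~ depth_ge ms (edge_gens K e) r.+1.
Proof.
move=> irr cardC [fs [sfs [_ [reg nt]]]].
have [M [c [[t tM /eqP ct] Ic]]] := edge_ideal_dependence irr cardC sfs.
apply: ct.
apply: (chain_independent (J := fun i => in_ideal (edge_gens K e ++ take i fs)) _ _ _ _ _ _ tM).
- by move=> i _; apply: in_ideal_is_ideal.
- move=> i ir g; apply: in_ideal_sub => h.
  by rewrite (take_nth 0) // !mem_cat mem_rcons inE => /orP[]->; rewrite ?orbT.
- move=> i ir; apply: mem_in_ideal.
  by rewrite (take_nth 0) // mem_cat mem_rcons inE eqxx orbT.
- exact: reg.
- by rewrite take_size.
- by rewrite take0 cats0.
Qed.

End EdgeIdeals.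

(** * Cohen-Macaulay bipartite graphs *)

Section CohenMacaulayBipartite.
Variables (K : fieldType) (V : finType) (e : rel V) (A : {set V}) (w : V -> V).
Local Notation rk := enum_rank.
Hypotheses (e_sym : ssrbool.symmetric e) (wK : involutive w).
Hypothesis wA : forall x, (w x \in A) = (x \notin A).
Hypothesis bip : forall x y, e x y -> (x \in A) = (y \notin A).
Hypothesis etrans : forall a c d, a \in A -> c \in A -> d \in A ->
  e a (w c) -> e c (w d) -> e a (w d).

(** Normal form modulo the differences [x_a - x_(w a)] for [a] in [t]: the partner of an element of
    [t] is replaced by that element. *)
Definition fold_partner (t : seq V) (x : V) := if w x \in t then w x else x.

Lemma fold_partner_A t a : {subset t <= A} -> a \in A -> fold_partner t a = a.
Proof.
move=> tA aA; rewrite /fold_partner; case: ifP => // /tA.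
by rewrite wA aA.
Qed.

Lemma edge_multiple_bipartite p m : edge_multiple e p m ->
  exists x y, [/\ e x y, x \in A, y \notin A &
    (U_(rk (p x)) + U_(rk (p y)) <= m)%MM].
Proof.
case/edge_multipleP => x [y [exy le]]; case: (boolP (x \in A)) => xA.
  by exists x, y; split=> //; rewrite -(bip exy).
exists y, x; split=> //; [by rewrite e_sym| |by rewrite addmC].
by have := bip exy; rewrite (negbTE xA); case: (y \in A).
Qed.

Lemma lepm_erase n (i j k : 'I_n) (u : 'X_{1..n}) l : i != k -> j != k ->
  (U_(i) + U_(j) <= u + U_(k) *+ l)%MM -> (U_(i) + U_(j) <= u)%MM.
Proof.
move=> ik jk /mnm_lepP le; apply/mnm_lepP => x; have := le x.
rewrite !mnmDE mulmnE !mnm1E; case: (eqVneq k x) => [<-|_]; last by rewrite mul0n addn0.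
by rewrite (negbTE ik) (negbTE jk).
Qed.

Lemma lepm_two n (i j : 'I_n) (u : 'X_{1..n}) : i != j -> (0 < u i)%N -> (0 < u j)%N ->
  (U_(i) + U_(j) <= u)%MM.
Proof.
move=> ij ui uj; apply/mnm_lepP => x; rewrite mnmDE !mnm1E.
case: (eqVneq i x) => [<-|_]; first by rewrite eq_sym (negbTE ij).
by case: eqP => // <-.
Qed.

(** The extra factors matter only for an edge from [a] to some [y] and one from some [x'] to [w a].
    By [etrans], [x'] and [y] are then adjacent, and both divide [u]. Since [a] has no edge to
    partners of [t], the vertex [y] is not renamed. *)
Lemma edge_multiple_fold_nzd t a u k l : {subset t <= A} -> a \in A -> a \notin t ->
  (forall c, c \in t -> ~~ e a (w c)) ->
  edge_multiple e (fold_partner t) (u + U_(rk a) *+ k)%MM ->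
  edge_multiple e (fold_partner t) (u + U_(rk (w a)) *+ l)%MM ->
  edge_multiple e (fold_partner t) u.
Proof.
move=> tA aA at' nea /edge_multiple_bipartite[x [y [exy xA yA le1]]].
case/edge_multiple_bipartite => x' [y' [exy' xA' yA' le2]].
have neq v v' : v \in A -> v' \notin A -> rk v != rk v'.
  by move=> vA vA'; apply/eqP => /enum_rank_inj E; move: vA'; rewrite -E vA.
have waA : w a \notin A by rewrite wA negbK.
have fya : fold_partner t y != a.
  rewrite /fold_partner; case: ifP => [wyt|_]; apply/eqP => E.
    by move: at'; rewrite -E wyt.
  by move: yA; rewrite E aA.
case: (eqVneq x a) => [xa|xa]; last first.
  apply/edge_multipleP; exists x, y; split=> //; apply: lepm_erase le1.
    by rewrite fold_partner_A // (inj_eq enum_rank_inj).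
  by rewrite (inj_eq enum_rank_inj).
case: (eqVneq y' (w a)) => [ya|ya]; last first.
  apply/edge_multipleP; exists x', y'; split=> //; apply: lepm_erase le2.
    by rewrite fold_partner_A // neq.
  rewrite (inj_eq enum_rank_inj) /fold_partner; case: ifP => // _.
  by apply/eqP => /(can_inj wK) E; move: yA'; rewrite E aA.
subst x y'.
have wyt : w y \notin t.
  by apply/negP => /nea; rewrite wK exy.
have fy : fold_partner t y = y by rewrite /fold_partner (negbTE wyt).
apply/edge_multipleP; exists x', y; split.
  by rewrite -[y]wK; apply: etrans exy' _; rewrite ?wA // wK.
rewrite fy fold_partner_A //; apply: lepm_two; first exact: neq.
  move/mnm_lepP/(_ (rk x')): le2; rewrite fold_partner_A // !mnmDE mulmnE !mnm1E eqxx.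
  by rewrite [rk (w a) == _]eq_sym (negbTE (neq _ _ xA' waA)) mul0n addn0; apply: leq_trans; apply: leq_addr.
move/mnm_lepP/(_ (rk y)): le1; rewrite fy !mnmDE mulmnE !mnm1E eqxx.
by rewrite (negbTE (neq _ _ aA yA)) mul0n addn0; apply: leq_trans; apply: leq_addl.
Qed.

Lemma in_fold_ideal t f : {subset t <= A} ->
  in_ideal (edge_gens K e ++ [seq var K a - var K (w a) | a <- t]) f <->
  monomial_ideal (edge_multiple e (fold_partner t)) (f \mPo vsubst K (fold_partner t)).
Proof.
move=> tA; apply: in_edge_ideal_vsubst => [g /mapP[a at' ->]|v].
  by rewrite comp_mpolyB !vsubst_var fold_partner_A ?tA // /fold_partner wK at' subrr.
rewrite /fold_partner; case: ifP => [wt|_]; last first.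
  by rewrite subrr; case: (in_ideal_is_ideal [seq var K a - var K (w a) | a <- t]).
rewrite -opprB; apply: idealN; first exact: in_ideal_is_ideal.
by apply: mem_in_ideal; apply/mapP; exists (w v); rewrite ?wK.
Qed.

(* The elements [x_a - x_(w a)], taken along [s], form a regular sequence:
   modulo the first ones the edge ideal stays monomial ([in_fold_ideal]). *)
Lemma CM_bipartite (s : seq V) : irreflexive e ->
  (forall C, min_vertex_cover e C -> #|~: C| = #|A|) ->
  uniq s -> s =i A -> pairwise (fun x y => ~~ e y (w x)) s -> CM_graph K e.
Proof.
move=> irr cardC us sA ps; exists #|A|; split; split.
- have : vertex_cover e setT by apply/vertex_coverP => x y _; rewrite !inE.
  case/min_vertex_cover_exists => C mC _; rewrite -(cardC C mC).
  by apply: dim_ge_independent; case/andP: mC.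
- exact: krull_dim_edge_ideal.
- pose fs := [seq var K a - var K (w a) | a <- s].
  have sizes : size s = #|A| by rewrite -(card_uniqP us); apply: eq_card.
  exists fs; split; first by rewrite size_map.
  have takeA k : {subset take k s <= A} by move=> x /mem_take; rewrite sA.
  split; last split.
  + move=> k; rewrite size_map => ks.
    have [v0 _] : exists v, v \in A by apply/card_gt0P; rewrite -sizes; apply: leq_ltn_trans ks.
    rewrite (nth_map v0) //; apply: idealB; first exact: in_ideal_is_ideal.
      by apply: mem_in_ideal; rewrite map_f // mem_enum.
    by apply: mem_in_ideal; rewrite map_f // mem_enum.
  + move=> k; rewrite size_map => ks g.
    have [v0 _] : exists v, v \in A by apply/card_gt0P; rewrite -sizes; apply: leq_ltn_trans ks.
    rewrite (nth_map v0) // -map_take; set a := nth v0 s k.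
    have aA : a \in A by rewrite -sA mem_nth.
    have at' : a \notin take k s.
      have := take_uniq k.+1 us; rewrite (take_nth v0) // rcons_uniq.
      by case/andP.
    have nea c : c \in take k s -> ~~ e a (w c).
      move=> ct; move: ps; rewrite -(cat_take_drop k s) pairwise_cat => /and3P[/allrelP H _ _].
      by apply: H => //; rewrite (drop_nth v0) // mem_head.
    rewrite !in_fold_ideal // rmorphM /= comp_mpolyB !vsubst_var fold_partner_A //.
    have -> : fold_partner (take k s) (w a) = w a.
      by rewrite /fold_partner wK (negbTE at').
    apply: monomial_ideal_nzd; first exact: edge_multiple_up.
      by apply/eqP => /enum_rank_inj E; have := wA a; rewrite -E aA.
    by move=> u i j; apply: edge_multiple_fold_nzd.
  rewrite in_fold_ideal; last by move=> x; rewrite sA.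
  rewrite rmorph1 => /(_ 0%MM); rewrite -mpolyC1 msupp1 inE eqxx => /(_ isT).
  case/edge_multipleP => x [y [_ /mnm_lepP/(_ (rk (fold_partner s x)))]].
  by rewrite mnmDE mnm1E eqxx mnm0E.
- exact: depth_edge_ideal.
Qed.

End CohenMacaulayBipartite.

(** * Walks of covers in a bipartite graph *)

Section BipartiteWalk.
Local Open Scope nat_scope.
Variables (V : finType) (e : rel V) (A : {set V}).
Hypotheses (e_sym : ssrbool.symmetric e) (irr : irreflexive e).
Hypothesis bip : forall x y, e x y -> (x \in A) = (y \notin A).
Hypothesis coverA : forall C, vertex_cover e C -> #|A| <= #|C|.
Implicit Types (C D E : {set V}) (s : seq (V * V)).

Definition exchange : rel {set V} := fun C D =>
  [&& vertex_cover e D, #|D| == #|A|, #|C :\: D| <= 1 & #|D :\: C| <= 1].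

(** [E] arises from [A] by trading first components for second ones along [s], newest exchange
    first; by the last clause, a vertex of [A] given up earlier has no edge to a vertex taken in
    later. *)
Definition matching_of s E :=
  [/\ uniq (unzip1 s) /\ uniq (unzip2 s),
      forall p, p \in s -> [/\ p.1 \in A, p.2 \notin A & e p.1 p.2],
      forall x, x \in A -> (x \in E) = (x \notin unzip1 s),
      forall x, x \notin A -> (x \in E) = (x \in unzip2 s) &
      pairwise (fun p q => ~~ e q.1 p.2) s].

(** The lattice operations on covers of a bipartite graph, for the order in which smaller means less
    inside [A] and more outside. *)
Definition meet_cover C D := [set x | if x \in A then (x \in C) && (x \in D)
                                      else (x \in C) || (x \in D)].
Definition join_cover C D := [set x | if x \in A then (x \in C) || (x \in D)
                                      else (x \in C) && (x \in D)].

Lemma meet_cover_cover C D : vertex_cover e C -> vertex_cover e D ->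
  vertex_cover e (meet_cover C D).
Proof.
move=> /vertex_coverP cC /vertex_coverP cD; apply/vertex_coverP => x y exy.
have := bip exy; rewrite !inE; case: (x \in A); case: (y \in A) => // _.
  by rewrite negb_and => /orP[/(cC _ _ exy) ->|/(cD _ _ exy) ->]; rewrite ?orbT.
by rewrite negb_or => /andP[/(cC _ _ exy) -> /(cD _ _ exy) ->].
Qed.

Lemma join_cover_cover C D : vertex_cover e C -> vertex_cover e D ->
  vertex_cover e (join_cover C D).
Proof.
move=> /vertex_coverP cC /vertex_coverP cD; apply/vertex_coverP => x y exy.
have := bip exy; rewrite !inE; case: (x \in A); case: (y \in A) => // _.
  by rewrite negb_or => /andP[/(cC _ _ exy) -> /(cD _ _ exy) ->].
by rewrite negb_and => /orP[/(cC _ _ exy) ->|/(cD _ _ exy) ->]; rewrite ?orbT.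
Qed.

(** Meet and join have together as many vertices as [C] and [D], and neither has fewer than
    [#|A|]. *)
Lemma card_meet_cover C D : vertex_cover e C -> vertex_cover e D ->
  #|C| = #|A| -> #|D| = #|A| -> #|meet_cover C D| = #|A|.
Proof.
move=> cC cD sC sD; have card1 (X : {set V}) : #|X| = \sum_x (x \in X).
  by rewrite -sum1_card big_mkcond.
have : #|meet_cover C D| + #|join_cover C D| = #|C| + #|D|.
  rewrite !card1 -!big_split; apply: eq_bigr => x _ /=; rewrite !inE.
  by case: (x \in A); case: (x \in C); case: (x \in D).
have := coverA (meet_cover_cover cC cD); have := coverA (join_cover_cover cC cD).
by rewrite sC sD; lia.
Qed.

(* Meeting with all the covers of the walk seen so far makes the walk monotone. *)
Lemma matching_step C D E s : exchange C D ->
  vertex_cover e E -> #|E| = #|A| -> E :&: A \subset C -> C :\: A \subset E ->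
  matching_of s E ->
  exists E' s', [/\ vertex_cover e E', #|E'| = #|A|, E' :&: A \subset D,
    D :\: A \subset E' & matching_of s' E'].
Proof.
case/and4P => cD /eqP sD /card_le1_eqP CD /card_le1_eqP DC cE sE /subsetP EC /subsetP CE ms.
set E' := meet_cover E D; have cE' := meet_cover_cover cE cD.
have sE' := card_meet_cover cE cD sE sD; rewrite -/E' in cE' sE'.
have E'D : E' :&: A \subset D.
  by apply/subsetP => x; rewrite !inE => /andP[+ xA]; rewrite xA => /andP[].
have DE' : D :\: A \subset E'.
  by apply/subsetP => x; rewrite !inE => /andP[/negbTE -> ->]; rewrite orbT.
case: (eqVneq E' E) => [EE|neE].
  by exists E, s; split=> //; rewrite -EE.
(* A vertex leaving [E] lies in [A] and in [C :\: D]; one entering lies outside [A] and in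
   [D :\: C]. As [E'] differs from [E] but has the same size, there is exactly one of each. *)
have EE'CD x : x \in E -> x \notin E' -> (x \in A) && (x \in C :\: D).
  move=> xE; rewrite !inE xE /=; case: ifP => //= xA ->.
  by apply: EC; rewrite inE xE.
have E'EDC x : x \in E' -> x \notin E -> (x \notin A) && (x \in D :\: C).
  move=> + xE; rewrite !inE (negbTE xE) /=; case: ifP => //= xA ->; rewrite andbT.
  by apply: contra xE => xC; apply: CE; rewrite inE xA.
have [x xE xE'] : exists2 x, x \in E & x \notin E'.
  by apply/subsetPn; apply: contra neE => EE'; rewrite eq_sym eqEcard EE' sE sE' leqnn.
have [y yE' yE] : exists2 y, y \in E' & y \notin E.
  by apply/subsetPn; apply: contra neE => EE'; rewrite eqEcard EE' sE sE' leqnn.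
have /andP[xA xCD] := EE'CD x xE xE'; have /andP[yA yDC] := E'EDC y yE' yE.
have xuniq z : z \in E -> z \notin E' -> z = x.
  by move=> zE zE'; have /andP[_ zCD] := EE'CD z zE zE'; apply: CD.
have yuniq z : z \in E' -> z \notin E -> z = y.
  by move=> zE' zE; have /andP[_ zDC] := E'EDC z zE' zE; apply: DC.
move/vertex_coverP: (cE') => covE'; move/vertex_coverP: (cE) => covE.
(* Without this edge, [E :\ x] would be a cover with fewer than [#|A|] vertices. *)
have exy : e x y.
  apply/negPn/negP => nexy; suff /coverA : vertex_cover e (E :\ x).
    by rewrite -sE (cardsD1 x E) xE ltnn.
  apply/vertex_coverP => u v euv; rewrite !inE negb_and negbK => /orP[/eqP ux|uE].
    subst u; have vE' : v \in E' by apply: covE' euv xE'.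
    have vx : v != x by apply/eqP => vx; move: euv; rewrite vx irr.
    rewrite vx; apply/negPn/negP => /(yuniq v vE') vy.
    by move: nexy; rewrite -vy euv.
  rewrite (covE u v euv uE) andbT; apply/eqP => vx; subst v.
  have uE' : u \in E' by apply: covE' xE'; rewrite e_sym.
  by move: nexy; rewrite -(yuniq u uE' uE) e_sym euv.
have [[u1 u2] sA sE1 sE2 ps] := ms.
exists E', ((x, y) :: s); split=> //; split.
- by rewrite /= u1 u2 -(sE1 x xA) -(sE2 y yA) xE yE.
- by move=> p; rewrite in_cons => /orP[/eqP ->|/sA].
- move=> z zA; rewrite /= in_cons negb_or -(sE1 z zA).
  case: (eqVneq z x) => [->|zx] /=; first exact/negbTE.
  apply/idP/idP => [|zE]; first by rewrite inE zA => /andP[].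
  by apply/negPn/negP => /(xuniq z zE) /eqP; rewrite (negbTE zx).
- move=> z zA; rewrite /= in_cons -(sE2 z zA).
  case: (eqVneq z y) => [->|zy] //=.
  apply/idP/idP => [zE'|zE]; last by rewrite inE (negbTE zA) zE.
  by apply/negPn/negP => /(yuniq z zE') /eqP; rewrite (negbTE zy).
(* Vertices given up earlier are not in [E], and neither is [y], so an edge between them would be
   uncovered. *)
- rewrite /= ps andbT; apply/allP => -[a b] abs /=.
  apply/negP => /covE; rewrite (negbTE yE) (sE1 a); last by case: (sA _ abs).
  by rewrite negbK (map_f fst abs) => /(_ isT).
Qed.

(** The invariant keeps [E] below the current cover [C] of the walk; [~: A] is the least set in this
    order, so [E] ends there too. *)
Lemma matching_walk C E s p : path exchange C p ->
  vertex_cover e E -> #|E| = #|A| -> E :&: A \subset C -> C :\: A \subset E ->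
  matching_of s E -> last C p = ~: A ->
  exists2 s', matching_of s' (~: A) & vertex_cover e (~: A).
Proof.
elim: p C E s => [|D p IH] C E s /=.
  move=> _ cE _ EC CE ms CA; suff <- : E = ~: A by exists s.
  apply/setP => x; rewrite inE; case: (boolP (x \in A)) => xA /=.
    apply/negP => xE; have /subsetP/(_ x) := EC.
    by rewrite CA !inE xE xA => /(_ isT).
  by have /subsetP/(_ x) := CE; rewrite CA !inE xA => /(_ isT).
case/andP => CD pD cE sE EC CE ms lD.
have [E' [s' [cE' sE' ED DE ms']]] := matching_step CD cE sE EC CE ms.
exact: IH pD cE' sE' ED DE ms' lD.
Qed.

Lemma matching_exists p : vertex_cover e A -> path exchange A p ->
  last A p = ~: A -> exists s, matching_of s (~: A).
Proof.
move=> cA pA lA.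
have [] := matching_walk (E := A) (s := [::]) pA => //.
- exact: subsetIr.
- by rewrite setDv sub0set.
- by split=> // x xA; apply: negbTE.
by move=> s ms _; exists s.
Qed.

Hypothesis unmixedA : forall C, min_vertex_cover e C -> #|C| = #|A|.

(* A minimal cover avoiding [a] and [w d] would contain both [c] and [w c]. *)
Lemma matching_trans (w : V -> V) :
  involutive w -> (forall x, (w x \in A) = (x \notin A)) ->
  (forall a, a \in A -> e a (w a)) ->
  forall a c d, a \in A -> c \in A -> d \in A -> e a (w c) -> e c (w d) -> e a (w d).
Proof.
move=> wK wA ew a c d aA cA dA eac ecd; apply/negPn/negP => nad.
have : vertex_cover e (~: [set a; w d]).
  apply/vertex_coverP => x y exy; rewrite !inE negbK => xad; apply/negP => yad.
  move: exy; case/orP: xad => /eqP ->; case/orP: yad => /eqP ->; rewrite ?irr ?(negbTE nad) //.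
  by rewrite e_sym (negbTE nad).
case/min_vertex_cover_exists => D mD /subsetP Dad.
have sD := unmixedA mD; case/andP: mD => /vertex_coverP cD _.
have aD : a \notin D by apply/negP => /Dad; rewrite !inE eqxx.
have wdD : w d \notin D by apply/negP => /Dad; rewrite !inE eqxx orbT.
have wcD : w c \in D by apply: cD eac aD.
have cDD : c \in D by apply: cD wdD; rewrite e_sym.
pose f x := if x \in D then x else w x.
have finj : {in A &, injective f}.
  move=> x y xA yA; rewrite /f; case: ifP => _; case: ifP => _ //.
  - by move=> E; move: xA; rewrite E wA yA.
  - by move=> E; move: yA; rewrite -E wA xA.
  - exact: can_inj wK x y.
have : f @: A \subset D :\ w c.
  apply/subsetP => _ /imsetP[x xA ->]; rewrite !inE /f; case: ifP => xD.
    by rewrite xD andbT; apply/eqP => E; move: xA; rewrite E wA cA.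
  rewrite (cD _ _ (ew x xA)) ?xD // andbT; apply/eqP => /(can_inj wK) E.
  by move: xD; rewrite E cDD.
move/subset_leq_card; rewrite card_in_imset //.
by rewrite -sD (cardsD1 (w c) D) wcD ltnn.
Qed.

Lemma CM_of_walk (K : fieldType) p : vertex_cover e A -> #|~: A| = #|A| ->
  path exchange A p -> last A p = ~: A -> CM_graph K e.
Proof.
move=> cA cardA pA lA; have [s [[u1 u2] sA sE1 sE2 ps]] := matching_exists cA pA lA.
(* A matching that reaches [~: A] uses every vertex once; [w] sends it to the other member of its
   pair, and the default [x] of [nth] is never reached. *)
pose w x := if x \in A then nth x (unzip2 s) (index x (unzip1 s))
            else nth x (unzip1 s) (index x (unzip2 s)).
have w12 q : q \in s -> w q.1 = q.2 /\ w q.2 = q.1.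
  move=> qs; have [q1 q2 _] := sA q qs.
  have is' : index q s < size s by rewrite index_mem.
  have E1 : index q.1 (unzip1 s) = index q s.
    by rewrite -{1}(nth_index q qs) -(nth_map q q.1 fst) // index_uniq // size_map.
  have E2 : index q.2 (unzip2 s) = index q s.
    by rewrite -{1}(nth_index q qs) -(nth_map q q.2 snd) // index_uniq // size_map.
  rewrite /w q1 (negbTE q2) E1 E2 (nth_map q) // (nth_map q) //.
  by rewrite nth_index.
have s1 x : x \in A -> exists2 q, q \in s & x = q.1.
  by move=> xA; have := sE1 x xA; rewrite inE xA => /esym/negbFE/mapP.
have s2 x : x \notin A -> exists2 q, q \in s & x = q.2.
  by move=> xA; have := sE2 x xA; rewrite inE xA => /esym/mapP.
have wK : involutive w.
  move=> x; case: (boolP (x \in A)) => [/s1|/s2] [q qs ->].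
    by case: (w12 q qs) => -> ->.
  by case: (w12 q qs) => w1 w2; rewrite w2 w1.
have wA x : (w x \in A) = (x \notin A).
  case: (boolP (x \in A)) => [/s1|/s2] [q qs ->]; have [q1 q2 _] := sA q qs.
    by case: (w12 q qs) => -> _; apply: negbTE.
  by case: (w12 q qs) => _ ->.
have ew a : a \in A -> e a (w a).
  by case/s1 => q qs ->; case: (w12 q qs) => -> _; case: (sA q qs).
apply: (@CM_bipartite K V e A w) (unzip1 s) _ _ _ _ _ => //.
- exact: matching_trans.
- move=> C mC; have := cardsC C; have := cardsC A; rewrite (unmixedA mC); lia.
- move=> x; apply/idP/idP => [/mapP[q qs ->]|/s1[q qs ->]]; last exact: map_f.
  by case: (sA q qs).
- rewrite pairwise_map; apply: (sub_in_pairwise (P := mem s)) ps => [q q' qs _ /=|].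
    by case: (w12 q qs) => -> _.
  exact/allP.
Qed.

End BipartiteWalk.

(** * Linear syzygies of cover ideals *)

Section LinearPresentation.
Variables (K : fieldType) (V : finType) (e : rel V).
Implicit Types C D U : {set V}.

Definition set_mnm C : 'X_{1..#|V|} := [multinom nat_of_bool (enum_val i \in C) | i < #|V|].

Lemma set_mnmE C v : set_mnm C (enum_rank v) = (v \in C).
Proof. by rewrite mnmE enum_rankK. Qed.

Lemma cover_monomialE C : cover_monomial K C = 'X_[set_mnm C].
Proof.
rewrite /cover_monomial /var mprodXE; congr 'X_[_]; apply/mnmP => i.
rewrite -[i]enum_valK set_mnmE mnm_sumE; set v := enum_val i.
rewrite (eq_bigr (fun x => nat_of_bool (x == v))); last first.
  by move=> x _; rewrite mnm1E (inj_eq enum_rank_inj).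
case: (boolP (v \in C)) => vC.
  by rewrite (bigD1 v) //= eqxx big1 // => x /andP[_ /negbTE ->].
by rewrite big1 // => x xC; case: eqP => // xv; move: vC; rewrite -xv xC.
Qed.

Definition cover_exchange U : rel {set V} := fun C D =>
  [&& min_vertex_cover e C, min_vertex_cover e D, C \subset U, D \subset U,
      (#|C :\: D| <= 1)%N & (#|D :\: C| <= 1)%N].

(** A vertex of [C] outside [D] can only come from the factor [X_j]. *)
Lemma set_mnm_shift C D (i j : 'I_#|V|) :
  (U_(i) + set_mnm C = U_(j) + set_mnm D)%MM -> (#|C :\: D| <= 1)%N.
Proof.
move=> /mnmP E; apply/card_le1_eqP.
suff H x : x \in C :\: D -> x = enum_val j by move=> x y /H -> /H ->.
rewrite inE => /andP[/negbTE xD xC]; apply/enum_rank_inj; rewrite enum_valK.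
have := E (enum_rank x); rewrite !mnmDE !set_mnmE !mnm1E xC xD addn0 addn1.
by case: (eqVneq j (enum_rank x)).
Qed.

(* In multidegree [q <= lcm], two generators occurring in a linear syzygy
   differ by one exchange, so a syzygy restricts to a syzygy on each component
   of the exchange graph, which the syzygy of [C1] and [C2] must then do too. *)
Lemma linearly_presented_connect C1 C2 : linearly_presented (cover_gens K e) ->
  min_vertex_cover e C1 -> min_vertex_cover e C2 ->
  connect (cover_exchange (C1 :|: C2)) C1 C2.
Proof.
move=> [_ [k [w [w1 [wsyz wgen]]]]] m1 m2; apply/negPn/negP => nT.
set r := cover_exchange _ in nT; set us := cover_gens K e in w w1 wsyz wgen.
pose L := min_covers e; pose Ci (i : 'I_(size us)) := nth set0 L i.
have ltL (i : 'I_(size us)) : (i < size L)%N.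
  have sz : size us = size L by rewrite /us /cover_gens size_map.
  by rewrite -sz.
have usE (i : 'I_(size us)) : us`_i = 'X_[set_mnm (Ci i)].
  by rewrite /us /cover_gens (nth_map set0) ?cover_monomialE // ltL.
have mCi i : min_vertex_cover e (Ci i).
  by have := mem_nth set0 (ltL i); rewrite mem_filter => /andP[].
have uL : uniq L by apply/filter_uniq/enum_uniq.
have idx C : min_vertex_cover e C -> exists i, forall j, (Ci j == C) = (j == i).
  move=> mC; have CL : C \in L by rewrite mem_filter mC mem_enum.
  have lt : (index C L < size us)%N by rewrite /us /cover_gens size_map index_mem.
  exists (Ordinal lt) => j; have jL := ltL j.
  by rewrite -{1}(nth_index set0 CL) nth_uniq ?index_mem.
have [i1 E1] := idx C1 m1; have [i2 E2] := idx C2 m2.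
have C12 : C1 != C2 by apply: contraNneq nT => ->; apply: connect0.
have C1i : Ci i1 = C1 by apply/eqP; rewrite E1.
have C2i : Ci i2 = C2 by apply/eqP; rewrite E2.
have i12 : i2 != i1 by rewrite -E1 C2i eq_sym.
pose m := set_mnm (C1 :|: C2).
have mD C D : (set_mnm (D :\: C) + set_mnm C = set_mnm (C :|: D))%MM.
  apply/mnmP => i; rewrite -[i]enum_valK mnmDE !set_mnmE !inE.
  by case: (_ \in C); case: (_ \in D).
(* The basic syzygy of [C1] and [C2]: both products with the generators are, up to sign, the least
   common multiple [X^m]. *)
pose g i : {mpoly K[#|V|]} := if Ci i == C1 then 'X_[set_mnm (C2 :\: C1)]
  else if Ci i == C2 then - 'X_[set_mnm (C1 :\: C2)] else 0.
have g1 : g i1 * us`_i1 = 'X_[m] by rewrite /g usE C1i eqxx -mpolyXD mD.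
have g2 : g i2 * us`_i2 = - 'X_[m].
  by rewrite /g usE C2i eqxx eq_sym (negbTE C12) mulNr -mpolyXD mD setUC.
have g0 i : i != i1 -> i != i2 -> g i * us`_i = 0.
  by move=> ne1 ne2; rewrite /g E1 E2 (negbTE ne1) (negbTE ne2) mul0r.
have [|a ga] := wgen g.
  rewrite (bigD1 i1) //= (bigD1 i2) //= big1 => [|i /andP[]]; last exact: g0.
  by rewrite g1 g2 addr0 subrr.
(* [T] marks the component of [C1]. It omits [C2], so the syzygy restricted to it sums to [X^m]
   instead of zero. *)
pose T i := connect r C1 (Ci i).
have gT : \sum_(i < size us | T i) g i * us`_i = 'X_[m].
  rewrite (bigD1 i1) /=; last by rewrite /T C1i connect0.
  rewrite big1 ?addr0 // => i /andP[Ti ne1]; apply: g0 => //.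
  by apply: contraNneq nT => ii; rewrite -C2i -ii.
(* The monomials not dividing [X^m] span an ideal; the contradiction will be that [X^m] lies in
   it. *)
have upm : up_closed (fun q => ~~ (q <= m)%MM).
  by move=> u v; apply: contra; apply: lepm_trans; apply: lem_addr.
have iI := monomial_ideal_is_ideal K upm.
suff /(_ m) : monomial_ideal (fun q => ~~ (q <= m)%MM) ('X_[m] : {mpoly K[#|V|]}).
  by rewrite msuppX inE eqxx lepm_refl => /(_ isT).
have -> : 'X_[m] = \sum_(j < k) a j * \sum_(i < size us | T i) w j i * us`_i :> {mpoly K[#|V|]}.
  rewrite -gT; under eq_bigr do rewrite ga mulr_suml.
  rewrite exchange_big; apply: eq_bigr => j _; rewrite mulr_sumr.
  by apply: eq_bigr => i _; rewrite mulrA.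
apply: ideal_sum => // j _; case: (iI) => _ _; apply=> q.
rewrite mcoeff_msupp => qn0; apply/negP => qm; case/negP: qn0; apply/eqP.
have shape i : (w j i * us`_i)@_q != 0 -> exists v, q = (U_(v) + set_mnm (Ci i))%MM.
  rewrite -mcoeff_msupp => /msuppM_le /allpairsP[[u v] /= []].
  rewrite usE msuppX inE => uw /eqP -> ->.
  have /eqP/mdeg1P[x /eqP ->] := dhomog_mf (w1 j i) uw; by exists x.
have sub i : (w j i * us`_i)@_q != 0 -> Ci i \subset C1 :|: C2.
  move=> /shape[v qE]; apply/subsetP => x xC; move/mnm_lepP/(_ (enum_rank x)): qm.
  by rewrite qE mnmDE !set_mnmE xC addn1; case: (_ \in _).
have rC i i' : (w j i * us`_i)@_q != 0 -> (w j i' * us`_i')@_q != 0 -> r (Ci i) (Ci i').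
  move=> ni ni'; have [v qE] := shape i ni; have [v' qE'] := shape i' ni'.
  have EE := etrans (esym qE) qE'.
  by apply/and5P; split; rewrite ?sub ?(set_mnm_shift EE) ?(set_mnm_shift (esym EE)).
rewrite raddf_sum /=.
(* Either no term in the component contributes to [q], or all contributing terms are in it and the
   restricted sum equals the full one, which is zero. *)
case: (boolP [exists i, T i && ((w j i * us`_i)@_q != 0)]); last first.
  move/existsPn => H; apply: big1 => i Ti; have := H i; rewrite Ti /= negbK.
  by move/eqP.
case/existsP => i0 /andP[T0 n0].
have : \sum_(i < size us) (w j i * us`_i)@_q = 0.
  by rewrite -[RHS](mcoeff0 K q) -[X in _ = X@__](wsyz j) raddf_sum.
rewrite (bigID T) /= [X in _ + X]big1 ?addr0 // => i nTi.
apply/eqP; apply: contraR nTi => ni.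
by apply: connect_trans T0 (connect1 _); apply: rC.
Qed.

End LinearPresentation.

(** * The induced graph on the symmetric difference *)

Section Restriction.
Variables (V : finType) (e : rel V) (L : {set V}).
Implicit Types C D : {set V}.

Definition restrict C : {set {x : V | x \in L}} := [set x | val x \in C].

Lemma card_restrict C : #|restrict C| = #|C :&: L|.
Proof.
rewrite -(card_imset _ val_inj); apply: eq_card => x; apply/imsetP/idP.
  by case=> y; rewrite !inE => yC ->; rewrite yC (valP y).
by rewrite inE => /andP[xC xL]; exists (Sub x xL); rewrite ?inE ?SubK.
Qed.

Lemma restrict_cover C : vertex_cover e C -> vertex_cover (induced e L) (restrict C).
Proof.
move=> /vertex_coverP cC; apply/vertex_coverP => x y exy; rewrite !inE.
exact: cC exy.
Qed.

Lemma card_restrictD C D : (#|restrict C :\: restrict D| <= #|C :\: D|)%N.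
Proof.
have -> : restrict C :\: restrict D = restrict (C :\: D).
  by apply/setP => x; rewrite !inE.
by rewrite card_restrict subset_leq_card // subsetIl.
Qed.

End Restriction.

Section SymmetricDifference.
Variables (V : finType) (e : rel V) (C1 C2 : {set V}).
Hypotheses (e_sym : ssrbool.symmetric e) (irr : irreflexive e).
Hypotheses (m1 : min_vertex_cover e C1) (m2 : min_vertex_cover e C2).
Local Notation H := (induced e (symdiff C1 C2)).
Local Notation res := (restrict (symdiff C1 C2)).

Lemma mem_symdiff x : x \in symdiff C1 C2 = (x \in C1) (+) (x \in C2).
Proof. by rewrite !inE; case: (x \in C1); case: (x \in C2). Qed.

(** A vertex of the symmetric difference lies in exactly one of the two covers, so an edge inside
    one side would be missed by the other cover. *)
Lemma symdiff_bipartite x y : H x y -> (x \in res C1) = (y \notin res C1).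
Proof.
move=> exy; case/andP: m1 => /vertex_coverP c1 _; case/andP: m2 => /vertex_coverP c2 _.
have := c1 _ _ exy; have := c2 _ _ exy; have := valP x; have := valP y.
rewrite !mem_symdiff !inE.
by do ![case: (_ \in _)] => //= _ _ h1 h2; rewrite ?h1 ?h2 //; have := h1 isT; have := h2 isT.
Qed.

(** Suppose a smaller cover omits [a]. All neighbours of [a] belong to [C1]: one outside would be in
    [C2], hence in the symmetric difference, and its edge to [a] would be uncovered. So [C1 :\ a]
    would already cover the whole graph. *)
Lemma restrict_min_cover : min_vertex_cover H (res C1).
Proof.
case/andP: m1 => cov1 min1; case/andP: m2 => cov2 _.
move/vertex_coverP: (cov1) => c1; move/vertex_coverP: (cov2) => c2.
rewrite /min_vertex_cover restrict_cover //=.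
apply/forallP => D; apply/implyP => /properP[/subsetP DA [x xA xD]].
apply/negP => /vertex_coverP cD; set a := val x; rewrite inE in xA.
have a2 : a \notin C2 by have := valP x; rewrite mem_symdiff xA; case: (_ \in C2).
have nbr v : e a v -> v \in C1.
  move=> eav; apply/negPn/negP => v1; have v2 := c2 _ _ eav a2.
  have vL : v \in symdiff C1 C2 by rewrite mem_symdiff (negbTE v1) v2.
  have /DA : Sub v vL \in D by apply: cD xD; rewrite /induced SubK.
  by rewrite inE SubK (negbTE v1).
have /forallP/(_ (C1 :\ a)) := min1; rewrite properD1 //=.
apply/negP; rewrite negbK; apply/vertex_coverP => u v euv.
rewrite !inE negb_and negbK => /orP[/eqP ua|u1].
  subst u; rewrite nbr // andbT; apply/eqP => va.
  by move: euv; rewrite va irr.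
rewrite (c1 _ _ euv u1) andbT; apply/eqP => va; subst v.
by move: u1; rewrite nbr // e_sym.
Qed.

Lemma card_restrict_symdiff (D : {set V}) : C1 :&: C2 \subset D -> D \subset C1 :|: C2 ->
  (#|res D| + #|C1 :&: C2| = #|D|)%N.
Proof.
move=> ID DU; rewrite card_restrict addnC -(cardsID (C1 :&: C2) D).
congr (_ + _)%N; apply: eq_card => x; rewrite !inE.
  by have /subsetP/(_ x) := ID; rewrite inE; case: (_ && _) => [->|]; rewrite ?andbF.
have /subsetP/(_ x) := DU; rewrite inE.
by case: (x \in D); case: (x \in C1); case: (x \in C2) => //= /(_ isT).
Qed.

End SymmetricDifference.

Theorem theorem5p15 (K : fieldType) (V : finType) (e : rel V) :
  simple_graph e ->
  unmixed e ->
  linearly_presented (cover_gens K e) ->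
  forall C1 C2 : {set V},
    min_vertex_cover e C1 -> min_vertex_cover e C2 -> C1 != C2 ->
    unmixed (induced e (symdiff C1 C2)) ->
    ~ CM_graph K (induced e (symdiff C1 C2)) ->
    exists C : {set V},
      [/\ min_vertex_cover e C, ~~ (C1 :&: C2 \subset C) & C \subset C1 :|: C2].
Proof.
move=> [e_sym irr] unm lp C1 C2 m1 m2 _ unmH nCM.
case: (boolP [exists C : {set V}, [&& min_vertex_cover e C,
    ~~ (C1 :&: C2 \subset C) & C \subset C1 :|: C2]]).
  by case/existsP => C /and3P[? ? ?]; exists C.
move/existsPn => noC; case: nCM.
have sub C : min_vertex_cover e C -> C \subset C1 :|: C2 -> C1 :&: C2 \subset C.
  by move=> mC CU; have := noC C; rewrite mC CU andbT /= negbK.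
set L := symdiff C1 C2; set H := induced e L; pose A := restrict L C1.
have mA : min_vertex_cover H A by apply: restrict_min_cover.
have unmA C : min_vertex_cover H C -> #|C| = #|A| by move=> mC; apply: unmH.
have cardA C : min_vertex_cover e C -> C \subset C1 :|: C2 -> #|restrict L C| = #|A|.
  move=> mC CU; have := card_restrict_symdiff (sub C mC CU) CU.
  have := card_restrict_symdiff (sub C1 m1 (subsetUl _ _)) (subsetUl _ _).
  by rewrite (unm C C1 mC m1) -/L -/A; lia.
(* The two sides of the bipartition are the restrictions of [C1] and [C2], the ends of the walk. *)
have AC : ~: A = restrict L C2.
  apply/setP => x; have := valP x; rewrite mem_symdiff !inE.
  by case: (_ \in C1); case: (_ \in C2).
have /connectP[p pr lp2] := linearly_presented_connect lp m1 m2.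
apply: (@CM_of_walk _ H A _ _ _ _ unmA K (map (restrict L) p)).
- by move=> x y; apply: e_sym.
- by move=> x; apply: irr.
- exact: symdiff_bipartite.
(* Unmixedness makes the minimal cover [A] a minimum one. *)
- move=> C /min_vertex_cover_exists[D mD DC].
  by rewrite -(unmA D mD) subset_leq_card.
- by case/andP: mA.
- by rewrite AC cardA // subsetUr.
- apply: homo_path pr => C D /and5P[mC mD CU DU /andP[CD DC]].
  apply/and4P; split.
  + by apply: restrict_cover; case/andP: mD.
  + by rewrite cardA.
  + exact: leq_trans (card_restrictD _ _ _) CD.
  + exact: leq_trans (card_restrictD _ _ _) DC.
- by rewrite last_map -lp2.
Qed.
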